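(* Every poly-hyperbolic group has the property of special symbol. In particular, every polycyclic group has the property of special symbol.
   Context: A group $\Gamma$ is *poly-hyperbolic* if there is a finite sequence of subgroups $\{1\}=N_0\lhd N_1\lhd\dots\lhd N_{k-1}\lhd N_k=\Gamma$ (each normal in the next) such that all quotients $N_{i+1}/N_i$ are (word-)hyperbolic groups. Let $\Gamma$ be a discrete group and $\mathcal{A}$ a finite discrete set (alphabet). $\mathcal{A}^{\Gamma}$ carries the product topology and the left $\Gamma$-action $(\gamma\sigma)(g)=\sigma(\gamma^{-1}g)$. A cylinder is a set $\mathcal{C}=\{\sigma\in\mathcal{A}^\Gamma : \sigma|_F\in M\}$, where $F\subset\Gamma$ is finite and $M\subset\mathcal{A}^F$. A subshift of finite type is a set of the form $\Phi=\bigcap_{\gamma\in\Gamma}\gamma^{-1}\mathcal{C}$ with $\mathcal{C}$ a cylinder. An action of $\Gamma$ on a compact space $K$ is *of finite type* if there are a finite alphabet $\mathcal{A}$, a subshift of finite type $\Phi\subset\mathcal{A}^\Gamma$ and a continuous surjective $\Gamma$-equivariant map $\pi:\Phi\to K$. It is *expansive* if there is a neighbourhood $U$ of the diagonal $\Delta\subset K\times K$ with $\Delta=\bigcap_{\gamma\in\Gamma}\gamma U$. It is *finitely presented* if it is both of finite type and expansive. Let $\hat \Gamma=\Gamma\cup\{\infty\}$ be the one-point compactification if $\Gamma$ is infinite and $\hat \Gamma=\Gamma$ if $\Gamma$ is finite; $\Gamma$ acts by left multiplication on $\Gamma$, fixing $\infty$. $\Gamma$ has *the property of special symbol* if the action of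 $\Gamma$ on $\hat \Gamma$ is finitely presented, by a subshift of finite type $\Phi\subset\mathcal{A}^\Gamma$ and a continuous surjective equivariant map $\pi:\Phi\to\hat \Gamma$ for which there is a symbol $\$\in\mathcal{A}$ such that, for all $\sigma\in\Phi$ and $\gamma\in \Gamma$, $\pi(\sigma)=\gamma$ if and only if $\sigma(\gamma)=\$$. *)

(* Defs.v *)
From HB Require Import structures.
From mathcomp Require Import all_boot all_order all_algebra finmap.
From mathcomp Require Import all_classical topology.

Set Implicit Arguments.
Unset Strict Implicit.
Unset Printing Implicit Defensive.

Import Order.TTheory GRing.Theory Num.Theory.
Local Open Scope classical_set_scope.
Local Open Scope group_scope.

Definition is_subgroup (G : groupType) (H : set G) : Prop :=
  H 1 /\ forall x y, H x -> H y -> H (x / y).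

Record is_normal (G : groupType) (N H : set G) : Prop := IsNormal {
  normal_subgroupl : is_subgroup N;
  normal_subgroupr : is_subgroup H;
  normal_sub : N `<=` H;
  normal_conj : forall n h, N n -> H h -> N (n ^ h) }.

Definition set_mulg (G : groupType) (A B : set G) : set G :=
  [set a * b | a in A & b in B].

Definition set_invg (G : groupType) (A : set G) : set G :=
  [set a^-1 | a in A].

Definition left_coset (G : groupType) (N : set G) (x : G) : set G :=
  [set x * n | n in N].

(* The quotient group H / N: the left cosets of N in H, with the setwise      *)
(* product and inverse.                                                       *)
Definition quotient (G : groupType) (N H : set G) (nNH : is_normal N H) : Type :=
  set_type (left_coset N @` H).

Section QuotientGroup.
Context (G : groupType) (N H : set G) (nNH : is_normal N H).
Implicit Types (A B C : set G) (x y : G).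

Let sN := normal_subgroupl nNH.
Let sH := normal_subgroupr nNH.

Let sgV (K : set G) x : is_subgroup K -> K x -> K x^-1.
Proof. by move=> [K1 KF] Kx; rewrite -[x^-1]mul1g; exact: KF. Qed.

Let sgM (K : set G) x y : is_subgroup K -> K x -> K y -> K (x * y).
Proof. by move=> sK Kx Ky; rewrite -[y]invgK; apply: sK.2 => //; exact: sgV. Qed.

Lemma left_coset_mul x y : H x -> H y ->
  set_mulg (left_coset N x) (left_coset N y) = left_coset N (x * y).
Proof.
move=> Hx Hy; apply/seteqP; split=> z.
- move=> [_ [a Na <-]] [_ [b Nb <-]] <-.
  exists (a ^ y * b); last by rewrite /conjg !mulgA mulgK.
  by apply: sgM => //; exact: (normal_conj nNH).
- move=> [n Nn <-]; exists x.
    by exists 1; [exact: sN.1|rewrite mulg1].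
  by exists (y * n); [exists n|rewrite mulgA].
Qed.

Lemma left_coset_inv x : H x ->
  set_invg (left_coset N x) = left_coset N x^-1.
Proof.
move=> Hx; have HVx := sgV sH Hx; apply/seteqP; split=> z.
- move=> [_ [n Nn <-] <-]; exists (n^-1 ^ x^-1).
    by apply: (normal_conj nNH) => //; exact: sgV.
  by rewrite /conjg invgK invgM mulKg.
- move=> [n Nn <-]; exists (n^-1 * x); last by rewrite invgM invgK.
  exists (n^-1 ^ x); last by rewrite /conjg mulVKg.
  by apply: (normal_conj nNH) => //; exact: sgV.
Qed.

Lemma left_coset_mul_subproof A B :
  (left_coset N @` H) A -> (left_coset N @` H) B ->
  (left_coset N @` H) (set_mulg A B).
Proof.
move=> [x Hx <-] [y Hy <-]; exists (x * y); first exact: sgM.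
by rewrite left_coset_mul.
Qed.

Lemma left_coset_inv_subproof A :
  (left_coset N @` H) A -> (left_coset N @` H) (set_invg A).
Proof.
by move=> [x Hx <-]; exists x^-1; [exact: sgV|rewrite left_coset_inv].
Qed.

Lemma left_coset_one_subproof : (left_coset N @` H) N.
Proof.
exists 1; first exact: sH.1.
apply/seteqP; split=> [z [n Nn <-]|n Nn]; first by rewrite mul1g.
by exists n => //; rewrite mul1g.
Qed.

Local Notation Q := (quotient nNH).

HB.instance Definition _ := Choice.copy Q (set_type (left_coset N @` H)).

Definition quotient_one : Q := SigSub (mem_set left_coset_one_subproof).

Definition quotient_mul (u v : Q) : Q :=
  SigSub (mem_set (left_coset_mul_subproof (set_valP u) (set_valP v))).

Definition quotient_inv (u : Q) : Q :=
  SigSub (mem_set (left_coset_inv_subproof (set_valP u))).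

Let left_coset1 : left_coset N 1 = N.
Proof.
apply/seteqP; split=> [z [n Nn <-]|n Nn]; first by rewrite mul1g.
by exists n => //; rewrite mul1g.
Qed.

Let quotient_eq (u v : Q) : sval u = sval v -> u = v.
Proof. by move=> uv; apply: val_inj. Qed.

Let quotientP (u : Q) : exists2 x, H x & sval u = left_coset N x.
Proof. by have [x Hx xu] := set_valP u; exists x. Qed.

Lemma quotient_mulA : associative quotient_mul.
Proof.
move=> u v w; apply: quotient_eq => /=.
have [x Hx ->] := quotientP u; have [y Hy ->] := quotientP v.
have [z Hz ->] := quotientP w.
by rewrite !left_coset_mul ?mulgA //; exact: sgM.
Qed.

Lemma quotient_mul1q : left_id quotient_one quotient_mul.
Proof.
move=> u; apply: quotient_eq => /=; have [x Hx ->] := quotientP u.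
by rewrite -[X in set_mulg X]left_coset1 left_coset_mul ?mul1g//; exact: sH.1.
Qed.

Lemma quotient_mulq1 : right_id quotient_one quotient_mul.
Proof.
move=> u; apply: quotient_eq => /=; have [x Hx ->] := quotientP u.
by rewrite -[X in set_mulg _ X]left_coset1 left_coset_mul ?mulg1//; exact: sH.1.
Qed.

Lemma quotient_mulVq : left_inverse quotient_one quotient_inv quotient_mul.
Proof.
move=> u; apply: quotient_eq => /=; have [x Hx ->] := quotientP u.
by rewrite left_coset_inv// left_coset_mul ?mulVg//; exact: sgV.
Qed.

Lemma quotient_mulqV : right_inverse quotient_one quotient_inv quotient_mul.
Proof.
move=> u; apply: quotient_eq => /=; have [x Hx ->] := quotientP u.
by rewrite left_coset_inv// left_coset_mul ?mulgV//; exact: sgV.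
Qed.

HB.instance Definition _ := isGroup.Build Q quotient_mulA quotient_mul1q
  quotient_mulq1 quotient_mulVq quotient_mulqV.

End QuotientGroup.

Definition poly_by (P : groupType -> Prop) (G : groupType) : Prop :=
  exists (k : nat) (N : nat -> set G),
    [/\ N 0%N = [set 1], N k = [set: G] &
        forall i, (i < k)%N ->
          exists nN : is_normal (N i) (N i.+1), P (quotient nN)].

(* g is the product of n letters taken in S or in its set of inverses.        *)
Definition is_word (G : groupType) (S : seq G) (g : G) (n : nat) : Prop :=
  exists w : seq G,
    [/\ size w = n, forall s, s \in w -> (s \in S) || (s^-1 \in S) &
        \prod_(s <- w) s = g].

Definition generates (G : groupType) (S : seq G) : Prop :=
  forall g, exists n, `[< is_word S g n >].

Definition word_length (G : groupType) (S : seq G) (gS : generates S) (g : G) :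
  nat := ex_minn (gS g).

Definition word_dist (G : groupType) (S : seq G) (gS : generates S) (x y : G) :
  nat := word_length gS (x^-1 * y).

Definition gromov_product (T : Type) (d : T -> T -> nat) (w x y : T) : rat :=
  (((d w x)%:R + (d w y)%:R - (d x y)%:R) / 2%:R)%R.

Definition gromov_hyperbolic (T : Type) (d : T -> T -> nat) : Prop :=
  exists2 delta : rat, (0 <= delta)%R & forall w x y z : T,
    (Num.min (gromov_product d w x y) (gromov_product d w y z) - delta
      <= gromov_product d w x z)%R.

(* Gromov's definition, for the word metric of some finite generating set.    *)
Definition hyperbolic_group (G : groupType) : Prop :=
  exists (S : seq G) (gS : generates S), gromov_hyperbolic (word_dist gS).

Definition cyclic_group (G : groupType) : Prop :=
  exists x : G, forall y, exists n, y = x ^+ n \/ y = x ^- n.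

Definition poly_hyperbolic : groupType -> Prop := poly_by hyperbolic_group.

Definition polycyclic : groupType -> Prop := poly_by cyclic_group.

Definition config (G : groupType) (A : finType) : topologicalType :=
  {ptws G -> discrete_topology A}.

Definition shift (G : groupType) (A : finType) (gamma : G)
  (sigma : config G A) : config G A := fun g => sigma (gamma^-1 * g).

Definition cylinder (G : groupType) (A : finType) (F : {fset G})
  (M : set (F -> A)) : set (config G A) :=
  [set sigma | M (fun x : F => sigma (val x))].

Definition subshift_of_finite_type (G : groupType) (A : finType)
  (Phi : set (config G A)) : Prop :=
  exists (F : {fset G}) (M : set (F -> A)),
    Phi = \bigcap_(gamma in [set: G]) (shift gamma^-1 @` cylinder M).

Section Actions.
Context (G : groupType) (K : topologicalType) (act : G -> K -> K).

(* Only the restriction of pi to Phi matters. *)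
Definition presents (A : finType) (Phi : set (config G A))
  (pi : config G A -> K) : Prop :=
  [/\ subshift_of_finite_type Phi, {within Phi, continuous pi},
      pi @` Phi = [set: K] &
      forall gamma sigma, Phi sigma ->
        pi (shift gamma sigma) = act gamma (pi sigma)].

Definition of_finite_type : Prop :=
  exists (A : finType) (Phi : set (config G A)) (pi : config G A -> K),
    presents Phi pi.

Definition expansive : Prop :=
  exists U : set (K * K),
    (exists V, [/\ open V, diagonal `<=` V & V `<=` U]) /\
    diagonal = \bigcap_(gamma in [set: G])
                 [set (act gamma p.1, act gamma p.2) | p in U].

Definition finitely_presented_action : Prop := of_finite_type /\ expansive.

(* K stands for the compactification of G, and i for the inclusion of G in K. *)
Definition special_symbol_for (i : G -> K) : Prop :=
  finitely_presented_action /\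
  exists (A : finType) (Phi : set (config G A)) (pi : config G A -> K),
    presents Phi pi /\
    exists dollar : A, forall sigma gamma, Phi sigma ->
      (pi sigma = i gamma <-> sigma gamma = dollar).

End Actions.

(* For finite G the compactification is G itself: the library's one-point     *)
(* compactification would then have an additional isolated point.             *)
Definition special_symbol_property (G : groupType) : Prop :=
  (finite_set [set: G] ->
     special_symbol_for (K := discrete_topology G)
       (fun gamma x => gamma * x) id) /\
  (infinite_set [set: G] ->
     special_symbol_for (K := one_point_compactification (discrete_topology G))
       (fun gamma => omap (fun x => gamma * x)) Some).

(* Main.v *)
Require Import Defs.
From mathcomp Require Import all_boot.
From mathcomp Require Import all_order all_algebra finmap lra zify.
From mathcomp Require Import all_classical topology.

Set Implicit Arguments.
Unset Strict Implicit.
Unset Printing Implicit Defensive.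

Import Order.TTheory GRing.Theory Num.Theory.
Local Open Scope classical_set_scope.
Local Open Scope group_scope.

(** The topology plays almost no part.  In a compactification of G by at most
    one point, a point is known once one knows which element of G, if any, it
    is; so the map to the compactification is determined by the position of
    the special symbol, and the property amounts to the existence of a finite
    local rule all of whose configurations show the symbol at most once, some
    of them showing it ([has_special_rule]).  Continuity, equivariance and
    expansiveness are then automatic ([special_symbol_of_rule]).  Two details
    remain.  For infinite G some configuration must lie over infinity: the
    letter [None] is added to the alphabet, and the rule lets a configuration be
    blank everywhere or nowhere ([special_symbol_infinite]).  For finite G every
    configuration must show the symbol, which is a rule on the window G.

    Rules pass to extensions ([has_special_rule_extension]).  The window F of a
    special rule on N generates N ([window_connected]): otherwise the rule would
    not relate distinct cosets of the subgroup generated by F, and a translate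
    of the symbol could be pasted into another coset.  Hence a local rule can force
    a letter to be constant on the cosets of N in H, so that it reads as a
    configuration on H / N; a second letter follows, on every coset, the rule of
    N.  The symbol of H is the pair of the two symbols: the first one selects a
    coset and the second one a point in it.

    For a hyperbolic group the configurations imitate the distance to a point.
    The letter at g is the distance from g to 1 modulo 3, with a flag at g = 1,
    and the rule allows the patterns that occur on balls of radius R in the
    translates of this configuration.  Along an edge the distance changes by at
    most 1, so the residues modulo 3 determine its variation.  Suppose that
    the flag occurs at x and at y <> x, and integrate these variations along a
    geodesic from x to y.  The resulting function increases on the first R steps
    and decreases on the last R steps, so it is maximal at some point at least R
    away from both ends.  Around that point it is the distance to some p, up to
    a constant, and p is at most as far from the two points at distance R as from
    the middle one.  The four-point condition forbids this when R exceeds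
    twice the hyperbolicity constant ([has_special_rule_hyperbolic]).

    Infinite cyclic groups have a rule of the same kind, with the sign of the
    exponent in place of the distance ([has_special_rule_cyclic]). *)

(** * Local rules *)

Section Rules.
Context (G : groupType) (A : finType).
Implicit Types (H : set G) (F : seq G) (rule : (G -> A) -> Prop).

Definition local_rule F rule : Prop :=
  forall sigma tau : G -> A, {in F, sigma =1 tau} -> rule sigma -> rule tau.

(** The rule is read at the points of H only, but configurations are defined
    on all of G: subgroups and their ambient group share one type. *)
Definition obeys H rule (sigma : G -> A) : Prop :=
  forall h, H h -> rule (fun g => sigma (h * g)).

End Rules.

(** * From local rules to finitely presented actions *)

Section Bridge.
Context (G : groupType) (A : finType) (F : seq G) (rule : (G -> A) -> Prop).

Definition sft : set (config G A) := [set sigma | obeys [set: G] rule sigma].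

Lemma sft_subshift (d : A) : local_rule F rule -> subshift_of_finite_type sft.
Proof.
move=> locF; exists [fset x in F]%fset.
exists [set m | rule (fun g => if insub g is Some u then m u else d)].
have cylE (sigma : config G A) :
    cylinder (F := [fset x in F]%fset)
      [set m | rule (fun g => if insub g is Some u then m u else d)] sigma
    <-> rule sigma.
  by split; apply: locF => g Fg; rewrite insubT ?inE.
apply/seteqP; split=> sigma.
- move=> ob gamma _; exists (fun g => sigma (gamma^-1 * g)).
    exact/cylE/ob.
  by apply/funext => g; rewrite /shift invgK mulKg.
- move=> ob h _; have [tau /cylE tauP <-] := ob h^-1 I.
  by apply: locF tauP => g _; rewrite /shift invgK mulKg.
Qed.

End Bridge.

Section IsolatedOrbit.
Context (G : groupType) (K : topologicalType) (act : G -> K -> K) (i : G -> K).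

(** The common features of G itself, for finite G, and of the one-point
    compactification of an infinite G; [i] is the inclusion of G.  The first
    field allows at most one point off the orbit. *)
Record isolated_orbit : Prop := IsolatedOrbit {
  orbit_separates : forall k k', (forall x, k = i x <-> k' = i x) -> k = k';
  orbit_act : forall gamma k x, act gamma k = i (gamma * x) <-> k = i x;
  orbit_clopen : forall x, clopen [set i x];
  orbit_cofinite : forall k W, (forall x, k <> i x) -> nbhs k W ->
    finite_set [set x | ~ W (i x)] }.

Hypothesis iO : isolated_orbit.

Lemma isolated_orbit_act gamma k x :
  act gamma k = i x <-> k = i (gamma^-1 * x).
Proof. by have := orbit_act iO gamma k (gamma^-1 * x); rewrite mulVKg. Qed.

(** The neighbourhood of the diagonal separates 1 from all other points; its
    translates separate any element of G from all other points. *)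
Lemma isolated_orbit_expansive : expansive act.
Proof.
exists [set p | p.1 = i 1 <-> p.2 = i 1]; split.
  exists [set p | p.1 = i 1 <-> p.2 = i 1]; split=> //; last first.
    by move=> p /= ->.
  rewrite (_ : mkset _ = fst @^-1` [set i 1] `&` snd @^-1` [set i 1] `|`
                         fst @^-1` (~` [set i 1]) `&` snd @^-1` (~` [set i 1]));
    last first.
    apply/seteqP; split=> -[a b] /=; last by tauto.
    by have [|] := pselect (a = i 1); tauto.
  have [o1 c1] := orbit_clopen iO 1.
  have open_fst (V : set K) : open V -> open (@fst K K @^-1` V).
    by move=> oV; apply: open_comp => // p _; exact: cvg_fst.
  have open_snd (V : set K) : open V -> open (@snd K K @^-1` V).
    by move=> oV; apply: open_comp => // p _; exact: cvg_snd.
  by apply: openU; apply: openI; (apply: open_fst || apply: open_snd) => //;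
    exact: closed_openC.
apply/seteqP; split=> -[a b].
- move=> /diagonalP <- gamma _.
  have actK : act gamma (act gamma^-1 a) = a.
    apply: (orbit_separates iO) => x.
    by rewrite !isolated_orbit_act invgK mulVKg.
  by exists (act gamma^-1 a, act gamma^-1 a); rewrite //= actK.
- move=> abU; apply: (orbit_separates iO) => x /=.
  have [[a' b'] /= ab'U [<- <-]] := abU x I.
  by rewrite !isolated_orbit_act mulVg.
Qed.

Context (A : finType) (F : seq G) (rule : (G -> A) -> Prop) (d : A).
Hypothesis locF : local_rule F rule.
Hypothesis mark_point : forall sigma, obeys [set: G] rule sigma ->
  exists k, forall x, k = i x <-> sigma x = d.
Hypothesis point_mark : forall k, exists2 sigma, obeys [set: G] rule sigma &
  forall x, k = i x <-> sigma x = d.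

Definition marked_point (sigma : config G A) : K :=
  xget (i 1) [set k | forall x, k = i x <-> sigma x = d].

Lemma marked_pointP (sigma : config G A) x : sft rule sigma ->
  marked_point sigma = i x <-> sigma x = d.
Proof. by move=> /mark_point mk; exact: (xgetPex (i 1) mk) x. Qed.

Lemma near_letter (sigma : config G A) x :
  \forall tau \near sigma, tau x = sigma x.
Proof.
have := @proj_continuous G (fun=> discrete_topology A) x sigma.
by move=> /(_ [set sigma x]); apply; exact: discrete_set1.
Qed.

(** Near a configuration over an element of G the symbol stays in place.  Near
    one without symbol it has left any given finite part of G, and the finite
    part to avoid is the complement of a neighbourhood of infinity. *)
Lemma marked_point_continuous : {within sft rule, continuous marked_point}.
Proof.
apply/subspace_continuousP => sigma sS W Wn.
have Wk := nbhs_singleton Wn.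
rewrite nbhs_simpl /= /within /=.
have [[x kx]|nox] := pselect (exists x, marked_point sigma = i x).
  have sx : sigma x = d by apply/marked_pointP.
  apply: filterS (near_letter sigma x) => tau tx tS.
  change (W (marked_point tau)).
  have -> : marked_point tau = i x by apply/marked_pointP; rewrite ?tx.
  by rewrite -kx.
have /finite_fsetP[B BE] : finite_set [set x | ~ W (i x)].
  by apply: orbit_cofinite Wn => // x kx; apply: nox; exists x.
have Bn : \forall tau \near sigma,
    (\bigcap_(x in [set` B]) [set tau : config G A | tau x = sigma x]) tau.
  by apply: filter_bigI => x _; exact: near_letter.
apply: filterS Bn => tau tB tS.
change (W (marked_point tau)).
have [[x kx]|nox'] := pselect (exists x, marked_point tau = i x); last first.
  have -> // : marked_point tau = marked_point sigma.
  apply: (orbit_separates iO) => x.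
  by split=> kx; [case: nox'|case: nox]; exists x.
rewrite kx; apply: contrapT => nW.
have Bx : [set` B] x by rewrite -BE.
apply: nox; exists x; apply/(marked_pointP _ sS).
by rewrite -(tB x Bx); apply/(marked_pointP _ tS).
Qed.

(** All required identities between points of K follow from
    [orbit_separates], by comparing positions of the symbol. *)
Lemma special_symbol_of_rule : special_symbol_for act i.
Proof.
have pres : presents act (sft rule) marked_point.
  split; [exact: sft_subshift d locF|exact: marked_point_continuous| |].
  - apply/seteqP; split=> // k _; have [sigma sS sk] := point_mark k.
    exists sigma => //; apply: (orbit_separates iO) => x.
    exact: iff_trans (marked_pointP x sS) (iff_sym (sk x)).
  - move=> gamma sigma sS; apply: (orbit_separates iO) => x.
    have shS : sft rule (shift gamma sigma).
      move=> h _; apply: locF (sS (gamma^-1 * h) I) => g _.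
      by rewrite /shift mulgA.
    exact: iff_trans (marked_pointP x shS)
             (iff_sym (iff_trans (isolated_orbit_act _ _ _) (marked_pointP _ sS))).
split.
  by split; [exists A, (sft rule), marked_point|exact: isolated_orbit_expansive].
exists A, (sft rule), marked_point; split=> //.
by exists d => sigma gamma sS; exact: marked_pointP.
Qed.

End IsolatedOrbit.

(** * Special rules on subgroups *)

Section Subgroups.
Context (G : groupType) (H : set G).
Hypothesis sH : is_subgroup H.

Lemma subgroupV x : H x -> H x^-1.
Proof. by move=> Hx; rewrite -[x^-1]mul1g; apply: sH.2 => //; exact: sH.1. Qed.

Lemma subgroupM x y : H x -> H y -> H (x * y).
Proof.
by move=> Hx Hy; rewrite -[y]invgK; apply: sH.2 => //; exact: subgroupV.
Qed.

End Subgroups.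

Record special_rule (G : groupType) (H : set G) (A : finType) (F : seq G)
  (rule : (G -> A) -> Prop) (d : A) : Prop := SpecialRule {
  special_window : forall f, f \in F -> H f;
  special_local : local_rule F rule;
  special_unique : forall sigma, obeys H rule sigma ->
    forall x y, H x -> H y -> sigma x = d -> sigma y = d -> x = y;
  special_exists : exists2 sigma, obeys H rule sigma &
    exists2 x, H x & sigma x = d }.

Definition has_special_rule (G : groupType) (H : set G) : Prop :=
  exists (A : finType) (F : seq G) rule (d : A), special_rule H F rule d.

Section SpecialRuleTheory.
Context (G : groupType) (H : set G) (sH : is_subgroup H).
Context (A : finType) (F : seq G) (rule : (G -> A) -> Prop) (d : A).
Hypothesis sR : special_rule H F rule d.

(** The translate of an obeying configuration obeys the rule. *)
Lemma special_at x : H x -> exists2 sigma, obeys H rule sigma & sigma x = d.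
Proof.
move=> Hx; have [sigma so [y Hy sy]] := special_exists sR.
exists (fun g => sigma (y * (x^-1 * g))); last by rewrite mulVg mulg1.
move=> h Hh; have := so (y * (x^-1 * h)).
rewrite (_ : (fun g => _) = fun g => sigma (y * (x^-1 * (h * g)))).
  by apply; do !apply: (subgroupM sH) => //; exact: subgroupV.
by apply/funext => g; rewrite !mulgA.
Qed.

(** The hypothesis on T says that T is a union of cosets of the subgroup
    generated by the window; so H is generated by the window.  Were n outside T,
    a configuration and its translate by n could be glued along T, since every
    window lies on one side, and the symbol would occur at 1 and at n. *)
Lemma window_connected (T : set G) : T 1 ->
  (forall h f, H h -> f \in F -> T h <-> T (h * f)) -> H `<=` T.
Proof.
move=> T1 TF n Hn; apply: contrapT => nTn.
have [sigma so s1] := special_at sH.1.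
pose tau g := if pselect (T g) then sigma g else sigma (n^-1 * g).
have to : obeys H rule tau.
  move=> h Hh; have [Th|nTh] := pselect (T h).
    apply: (special_local sR) (so h Hh) => f Ff; rewrite /tau.
    by case: pselect => // nThf; case: nThf; exact/(TF h f).
  have /so : H (n^-1 * h) by apply: (subgroupM sH) => //; exact: subgroupV.
  apply: (special_local sR) => f Ff; rewrite /tau mulgA.
  by case: pselect => // Thf; case: nTh; exact/(TF h f).
suff n1 : 1 = n by apply: nTn; rewrite -n1.
apply: (special_unique sR to) => //; first exact: sH.1.
  by rewrite /tau; case: pselect.
by rewrite /tau; case: pselect => [/nTn //|/= _]; rewrite mulVg.
Qed.

End SpecialRuleTheory.

(** * Extensions *)

Section Extension.
Context (G Q : groupType) (N H : set G) (p : G -> Q) (s : Q -> G).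
Hypothesis sH : is_subgroup H.
Hypothesis pM : forall x y, H x -> H y -> p (x * y) = p x * p y.
Hypothesis Hs : forall q, H (s q).
Hypothesis sK : cancel s p.
Hypothesis kerN : forall x, N x <-> H x /\ p x = 1.

Let p1 : p 1 = 1.
Proof. by apply: (mulgI (p 1)); rewrite -pM ?mulg1 //; exact: sH.1. Qed.

Let pV x : H x -> p x^-1 = (p x)^-1.
Proof.
move=> Hx; apply: (mulgI (p x)); rewrite -pM // ?mulgV ?p1 //.
exact: subgroupV.
Qed.

Let pN x n : H x -> N n -> p (x * n) = p x.
Proof. by move=> Hx /kerN[Hn pn]; rewrite pM // pn mulg1. Qed.

Let NVM x y : H x -> H y -> p x = p y -> N (x^-1 * y).
Proof.
move=> Hx Hy pxy; have HVx := subgroupV sH Hx; apply/kerN.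
split; first exact: subgroupM.
by rewrite pM // pV // pxy mulVg.
Qed.

Let sN : is_subgroup N.
Proof.
split=> [|x y /kerN[Hx px] /kerN[Hy py]]; apply/kerN.
  by split; [exact: sH.1|].
by split; [exact: sH.2|rewrite pM ?pV ?px ?py ?mulgV //; exact: subgroupV].
Qed.

(** The first component of a letter is a configuration of Q, made constant on
    the cosets of N through the window of N; the second component is an
    independent configuration of N on each coset. *)
Lemma has_special_rule_extension :
  has_special_rule N -> has_special_rule [set: Q] -> has_special_rule H.
Proof.
move=> [A [FN [ruleN [d rN]]]] [B [FQ [ruleQ [e rQ]]]].
have HN n : N n -> H n by move=> /kerN[].
pose rule (sigma : G -> B * A) :=
  [/\ forall n, n \in FN -> (sigma n).1 = (sigma 1).1,
      ruleQ (fun q => (sigma (s q)).1) & ruleN (fun n => (sigma n).2)].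
exists (B * A)%type, (1 :: FN ++ map s FQ), rule, (e, d); split.
- move=> f; rewrite inE mem_cat => /or3P[/eqP ->|/(special_window rN) /HN //|].
    exact: sH.1.
  by move=> /mapP[q _ ->].
- move=> sigma tau st [s1 sQ sNr].
  have stN n : n \in FN -> sigma n = tau n.
    by move=> Fn; apply: st; rewrite inE mem_cat Fn orbT.
  split.
  + by move=> n Fn; rewrite -stN // s1 // st // mem_head.
  + apply: (special_local rQ) sQ => q Fq; rewrite st // inE mem_cat.
    by rewrite (map_f s Fq) !orbT.
  + by apply: (special_local rN) sNr => n Fn; rewrite stN.
- move=> sigma so x y Hx Hy sx sy.
  have const h n : H h -> N n -> (sigma (h * n)).1 = (sigma h).1.
    move=> Hh.
    suff : N `<=` [set n | (sigma (h * n)).1 = (sigma h).1] by apply.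
    apply: (window_connected sN rN) => /= [|m f Nm Ff]; first by rewrite mulg1.
    have /so[] : H (h * m) by apply: (subgroupM sH) => //; exact: HN.
    by move=> /(_ f Ff); rewrite mulg1 mulgA => -> _ _.
  pose sigmaQ q := (sigma (s q)).1.
  have sigmaQE h : H h -> (sigma h).1 = sigmaQ (p h).
    move=> Hh; rewrite /sigmaQ -(const (s (p h)) ((s (p h))^-1 * h)) ?mulVKg //.
    by apply: NVM => //; rewrite sK.
  have soQ : obeys [set: Q] ruleQ sigmaQ.
    move=> q _; have [_ + _] := so (s q) (Hs q).
    congr ruleQ; apply/funext => q'; rewrite sigmaQE ?pM ?sK //.
    exact: subgroupM.
  have pxy : p x = p y.
    by apply: (special_unique rQ soQ) => //; rewrite -sigmaQE // (sx, sy).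
  have soN : obeys N ruleN (fun n => (sigma (x * n)).2).
    move=> n /HN Hn; have /so[_ _] : H (x * n) by exact: subgroupM.
    by congr ruleN; apply/funext => m; rewrite mulgA.
  suff : 1 = x^-1 * y.
    by move=> /(congr1 (fun g => x * g)); rewrite mulg1 mulVKg.
  apply: (special_unique rN soN) => /=; [exact: sN.1|exact: NVM| |].
    by rewrite mulg1 sx.
  by rewrite mulVKg sy.
- have [tQ oQ [q0 _ tq0]] := special_exists rQ.
  have [tN oN [n0 Nn0 tn0]] := special_exists rN.
  (* s (p g) is the base point chosen in the coset of g *)
  exists (fun g => (tQ (p g), tN ((s (p g))^-1 * g))); last first.
    exists (s q0 * n0); first by apply: (subgroupM sH) => //; exact: HN.
    by rewrite pN // sK mulKg tq0 tn0.
  move=> h Hh; split=> /=.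
  + by move=> n /(special_window rN) Nn; rewrite mulg1 pN.
  + have := oQ (p h) I.
    by congr ruleQ; apply/funext => q; rewrite pM // sK.
  + have Nm : N ((s (p h))^-1 * h) by apply: NVM => //; rewrite sK.
    apply: (special_local rN) (oN _ Nm) => n /(special_window rN) Nn.
    by rewrite pN // mulgA.
Qed.

End Extension.

Section QuotientStep.
Context (G : groupType) (N H : set G) (nN : is_normal N H).

Lemma left_coset_eq x y : H x ->
  left_coset N x = left_coset N y <-> N (x^-1 * y).
Proof.
have sN := normal_subgroupl nN; move=> Hx; split=> [xy|Nxy].
  have [n Nn <-] : left_coset N x y.
    by rewrite xy; exists 1; [exact: sN.1|exact: mulg1].
  by rewrite mulKg.
apply/seteqP; split=> z [n Nn <-].
  exists ((x^-1 * y)^-1 * n); last by rewrite invgM invgK -!mulgA mulVKg.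
  by apply: (subgroupM sN) => //; exact: subgroupV.
by exists (x^-1 * y * n); [exact: subgroupM|rewrite -!mulgA mulVKg].
Qed.

Lemma has_special_rule_quotient :
  has_special_rule N -> has_special_rule [set: quotient nN] ->
  has_special_rule H.
Proof.
have [sN sH] := (normal_subgroupl nN, normal_subgroupr nN).
pose p x : quotient nN :=
  if pselect (H x) is left Hx
  then SigSub (mem_set (imageP (left_coset N) Hx)) else 1.
have pE x : H x -> sval (p x) = left_coset N x.
  by rewrite /p; case: pselect.
have /choice[s sE] : forall q : quotient nN,
    exists x, H x /\ left_coset N x = sval q.
  by move=> q; have [x Hx xq] := set_valP q; exists x.
have Hs q : H (s q) by have [] := sE q.
have p1 : p 1 = 1.
  apply: val_inj; rewrite /= pE; last exact: sH.1.
  apply/seteqP; split=> [z [n Nn <-]|n Nn]; first by rewrite mul1g.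
  by exists n => //; rewrite mul1g.
apply: (has_special_rule_extension (p := p) (s := s)) => //.
- move=> x y Hx Hy; apply: val_inj.
  by rewrite /= !pE ?(left_coset_mul nN) //; exact: subgroupM.
- by move=> q; apply: val_inj; rewrite /= pE //; have [] := sE q.
- have kerE x : H x -> N x <-> p x = 1.
    have NE : N x <-> N (1^-1 * x) by rewrite invg1 mul1g.
    move=> Hx; rewrite NE -(left_coset_eq x sH.1) -(pE 1 sH.1) -(pE x Hx) -p1.
    by split=> [/val_inj ->|->].
  move=> x; split=> [Nx|[Hx /kerE]]; last exact.
  by have Hx := normal_sub nN Nx; split=> //; apply/kerE.
Qed.

End QuotientStep.

(** * Rules given by the patterns of one configuration *)

Section PatternRules.
Context (G : groupType) (A : finType) (F : seq G) (tau : G -> A).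

Definition pattern_rule (sigma : G -> A) : Prop :=
  exists gamma, {in F, forall f, sigma f = tau (gamma * f)}.

Lemma local_pattern_rule : local_rule F pattern_rule.
Proof.
by move=> sigma sigma' ss' [gamma sE]; exists gamma => f Ff; rewrite -ss' // sE.
Qed.

(** Since [tau] obeys its own pattern rule, only uniqueness of the symbol is
    left to prove for each choice of [tau]. *)
Lemma special_pattern_rule (d : A) : tau 1 = d ->
  (forall sigma, obeys [set: G] pattern_rule sigma ->
    forall x y, sigma x = d -> sigma y = d -> x = y) ->
  special_rule [set: G] F pattern_rule d.
Proof.
move=> t1 uniq_d; split=> //.
- exact: local_pattern_rule.
- by move=> sigma so x y _ _; exact: uniq_d.
- by exists tau; [move=> h _; exists h|exists 1].
Qed.

End PatternRules.

(** * Finite groups *)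

Section FiniteGroups.
Context (G : groupType) (F : seq G).
Hypothesis F_all : forall g, g \in F.

Let tau (g : G) := g == 1.

(** The window is the whole group, so the pattern seen at 1 is the whole
    configuration. *)
Lemma pattern_rule_finite sigma : obeys [set: G] (pattern_rule F tau) sigma ->
  exists k, forall x, k = x <-> sigma x = true.
Proof.
move=> so; have [gamma sE] := so 1 I; exists gamma^-1 => x.
have -> : sigma x = (gamma * x == 1) by rewrite -[x in LHS]mul1g sE.
by split=> [<-|/eqP /mulg1_eq //]; rewrite mulgV eqxx.
Qed.

Lemma has_special_rule_finite : has_special_rule [set: G].
Proof.
exists bool, F, (pattern_rule F tau), true; apply: special_pattern_rule.
  exact: eqxx.
by move=> sigma /pattern_rule_finite[k kE] x y /kE <- /kE.
Qed.

Lemma special_symbol_finite :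
  special_symbol_for (K := discrete_topology G) (fun gamma x => gamma * x) id.
Proof.
apply: (@special_symbol_of_rule _ _ _ _ _ _ F (pattern_rule F tau) true).
- split=> //.
  + by move=> k k' kk'; apply/esym/kk'.
  + by move=> gamma k x; split=> [/mulgI|->].
  + by move=> x; split; [exact: discrete_open|exact: discrete_closed].
  + by move=> k W /(_ k).
- exact: local_pattern_rule.
- exact: pattern_rule_finite.
- move=> k; exists (fun g => tau (k^-1 * g)).
    by move=> h _; exists (k^-1 * h) => f _; rewrite mulgA.
  by move=> x; split=> [->|/eqP /mulg1_eq]; rewrite ?invgK // /tau mulVg eqxx.
Qed.

End FiniteGroups.

(** * Infinite groups *)

Section InfiniteGroups.
Context (G : groupType).

Local Notation opc := (one_point_compactification (discrete_topology G)).

(** A cluster point of the filter of cofinite subsets of C would not be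
    isolated. *)
Lemma compact_discrete_finite (C : set (discrete_topology G)) :
  compact C -> finite_set C.
Proof.
move=> cC; apply: contrapT => infC.
pose cofinite : set_system (discrete_topology G) :=
  [set U | finite_set (C `\` U)].
have FF : ProperFilter cofinite.
  split; first by rewrite /cofinite /= setD0.
  split; rewrite /cofinite /=.
  - by rewrite setDT; exact: finite_set0.
  - move=> U V CU CV; change (finite_set (C `\` (U `&` V))).
    by rewrite setDIr finite_setU.
  - by move=> U V UV; apply: sub_finite_set => x [Cx nVx]; split=> // /UV.
have [|x [Cx]] := cC cofinite FF.
  by rewrite /cofinite /= setDv; exact: finite_set0.
case/(_ (~` [set x]) [set x]) => [| |y [] //]; last exact: discrete_set1.
rewrite /cofinite /=; apply: sub_finite_set (finite_set1 x).
by move=> y [_ /contrapT].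
Qed.

Lemma isolated_orbit_opc :
  @isolated_orbit G opc (fun gamma => omap (fun x => gamma * x)) Some.
Proof.
split.
- move=> [x|] [y|] kk' //; first by apply/esym/kk'.
  + by apply/esym/kk'.
  + by apply/kk'.
- by move=> gamma [y|] x //=; split=> [[/mulgI ->]|[->]].
- move=> x; split.
    rewrite -(image_set1 (Some : discrete_topology G -> opc) x).
    by apply: one_point_compactification_open_some; exact: discrete_open.
  rewrite -openC openE => -[y|] /= nyx.
    change (principal_filter y (Some @^-1` (~` [set Some x]))).
    exact/principal_filterP.
  exists [set x]; first by split; [exact: compact_set1|exact: discrete_closed].
  by move=> z [[y nxy <-]|->] //= [yx]; apply: nxy.
- move=> [y|] W nk; first by case: (nk y).
  move=> [C [cC _] CW]; apply: sub_finite_set (compact_discrete_finite cC).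
  by move=> x /= nW; apply: contrapT => nC; apply/nW/CW; left; exists x.
Qed.

Context (A : finType) (F : seq G) (rule : (G -> A) -> Prop) (d : A).
Hypothesis sR : special_rule [set: G] F rule d.

(** The blank configuration is the one to be sent to infinity.  The point 1 is
    added to the window so that the rule compares the letter at h with the
    letters of the window at h. *)
Definition blank_rule (sigma : G -> option A) : Prop :=
  {in 1 :: F, sigma =1 fun=> None} \/
  exists2 tau, rule tau & {in 1 :: F, forall f, sigma f = Some (tau f)}.

Let setTG : is_subgroup [set: G]. Proof. by []. Qed.

(** A single letter decides for the whole group, as the window generates it. *)
Lemma blank_rule_nowhere sigma x : obeys [set: G] blank_rule sigma ->
  sigma x <> None -> forall y, sigma y <> None.
Proof.
move=> so sx y; rewrite -(mulVKg x y).
suff : [set: G] `<=` [set g | sigma (x * g) <> None] by apply.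
apply: (window_connected setTG sR) => /= [|h f _ Ff]; first by rewrite mulg1.
rewrite mulgA; move: (x * h) => {}h.
have F1 : 1 \in 1 :: F by rewrite mem_head.
have Ff1 : f \in 1 :: F by rewrite inE Ff orbT.
by have [e|[tau _ e]] := so h I;
  move: (e _ F1) (e _ Ff1); rewrite mulg1 => -> ->.
Qed.

Lemma special_symbol_infinite :
  special_symbol_for (K := opc) (fun gamma => omap (fun x => gamma * x)) Some.
Proof.
apply: (@special_symbol_of_rule _ _ _ _ _ _ (1 :: F) blank_rule (Some d)).
- exact: isolated_orbit_opc.
- move=> sigma sigma' ss' [sN|[tau rt st]]; [left|right].
    by move=> f Ff; rewrite -ss' // sN.
  by exists tau => // f Ff; rewrite -ss' // st.
- move=> sigma so.
  have [[x sx]|nox] := pselect (exists x, sigma x = Some d); last first.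
    by exists None => x; split=> // sx; case: nox; exists x.
  have snN : forall y, sigma y <> None.
    by apply: (blank_rule_nowhere (x := x)) => //; rewrite sx.
  pose tau g := odflt d (sigma g).
  have to : obeys [set: G] rule tau.
    move=> h _; have [/(_ 1 (mem_head _ _))|[t rt st]] := so h I.
      by rewrite mulg1 => /snN.
    apply: (special_local sR) rt => f Ff.
    by rewrite /tau st // inE Ff orbT.
  exists (Some x) => y; split=> [[<-] //|sy]; congr Some.
  by apply: (special_unique sR to) => //; rewrite /tau (sx, sy).
- move=> [x|]; last by exists (fun=> None) => // h _; left.
  have [sigma so sx] := special_at setTG sR (x := x) I.
  exists (fun g => Some (sigma g)).
    by move=> h _; right; exists (fun g => sigma (h * g)) => //; exact: so.
  move=> y; split=> [[<-]|[sy]]; first by rewrite sx.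
  by congr Some; apply: (special_unique sR so).
Qed.

End InfiniteGroups.

(** In a finite group every configuration has to show the symbol, which a
    special rule does not ensure; there the rule with window G is used. *)
Lemma special_symbol_property_of_rule (G : groupType) :
  has_special_rule [set: G] -> special_symbol_property G.
Proof.
move=> [A [F [rule [d sR]]]]; split=> [/finite_fsetP[X XE]|_].
  apply: (special_symbol_finite (F := enum_fset X)) => g.
  by have : [set: G] g by []; rewrite XE.
exact: special_symbol_infinite sR.
Qed.

(** * Cyclic groups *)

(** For a generator x of infinite order, the rule with window {1, x} propagates
    in one direction: the letter for positive powers follows the symbol, and
    then itself.  So of two occurrences of the symbol the later one is
    impossible. *)
Lemma has_special_rule_cyclic (G : groupType) :
  cyclic_group G -> has_special_rule [set: G].
Proof.
move=> [x xG].
have [[m xm]|x_inf] := pselect (exists m, x ^+ m.+1 = 1).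
  have xk k : x ^+ k = x ^+ (k %% m.+1).
    by rewrite {1}(divn_eq k m.+1) expgnDr mulnC expgnA xm expg1n mul1g.
  pose pw := [seq x ^+ k | k <- iota 0 m.+1].
  have pwx k : x ^+ k \in pw.
    by rewrite xk; apply/map_f; rewrite mem_iota /= ltn_mod.
  apply: (has_special_rule_finite (F := pw ++ [seq g^-1 | g <- pw])) => g.
  rewrite mem_cat; have [n [] ->] := xG g; first by rewrite pwx.
  by rewrite (map_f (fun g => g^-1) (pwx n)) orbT.
pose pos (g : G) := exists n, g = x ^+ n.+1.
pose tau (g : G) : option bool := if g == 1 then None else Some `[< pos g >].
have tau_pos g : pos g -> tau g = Some true.
  move=> pg; rewrite /tau; case: eqP => [g1|_]; last by rewrite asboolT.
  by case: x_inf; have [n gn] := pg; exists n; rewrite -gn.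
exists (option bool), [:: 1; x], (pattern_rule [:: 1; x] tau), None.
apply: special_pattern_rule => [|sigma so]; first by rewrite /tau eqxx.
have step g :
    sigma g = None \/ sigma g = Some true -> sigma (g * x) = Some true.
  have [gamma sE] := so g I.
  rewrite -[g in sigma g]mulg1 !sE ?mulg1 ?inE ?eqxx ?orbT //.
  rewrite {1 2}/tau; case: eqP => [-> _|_].
    by apply: tau_pos; exists 0%N; rewrite mul1g.
  case=> // -[/asboolP[n ->]]; apply: tau_pos; exists n.+1.
  by rewrite -expgSr.
have after y n : sigma y = None -> sigma (y * x ^+ n.+1) = Some true.
  move=> sy; elim: n => [|n IHn]; first by rewrite expg1; apply: step; left.
  by rewrite expgSr mulgA; apply: step; right.
move=> y z sy sz; have [[|n] yz] := xG (y^-1 * z).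
  apply/esym; rewrite -[z](mulVKg y).
  by case: yz => ->; rewrite ?expg0 ?invg1 mulg1.
case: yz => yz.
  by move: (after y n sy); rewrite -yz mulVKg sz.
have zy : z^-1 * y = x ^+ n.+1 by rewrite -[x ^+ _]invgK -yz invgM invgK.
by move: (after z n sz); rewrite -zy mulVKg sy.
Qed.

(** * Word length *)

Section WordLength.
Context (G : groupType) (S : seq G) (gS : generates S).

Local Notation len := (word_length gS).

Lemma word_lengthP g : is_word S g (len g).
Proof. by rewrite /word_length; case: ex_minnP => n /asboolP. Qed.

Lemma word_length_min g n : is_word S g n -> (len g <= n)%N.
Proof.
by move=> gn; rewrite /word_length; case: ex_minnP => m _; apply; apply/asboolP.
Qed.

Lemma word_length1 : len 1 = 0%N.
Proof.
apply/eqP; rewrite -leqn0; apply: word_length_min.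
by exists [::]; split=> //; rewrite big_nil.
Qed.

Lemma word_lengthM g h : (len (g * h) <= len g + len h)%N.
Proof.
have [[v [<- vS <-]] [w [<- wS <-]]] := (word_lengthP g, word_lengthP h).
apply: word_length_min; exists (v ++ w); split.
- by rewrite size_cat.
- by move=> s; rewrite mem_cat => /orP[/vS|/wS].
- by rewrite big_cat.
Qed.

Lemma word_lengthV g : len g^-1 = len g.
Proof.
suff le h : (len h^-1 <= len h)%N.
  by apply/eqP; rewrite eqn_leq le -{1}[g]invgK le.
have [w [<- wS <-]] := word_lengthP h.
apply: word_length_min; exists [seq s^-1 | s <- rev w]; split.
- by rewrite size_map size_rev.
- by move=> s /mapP[t + ->]; rewrite mem_rev invgK orbC => /wS.
- by rewrite big_map prodgV revK.
Qed.

(** The prefixes of a shortest word: between two of them the letters in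
    between give the upper bound, and a shorter connection would shorten the
    word. *)
Lemma word_length_geodesic g : exists u : nat -> G,
  [/\ u 0%N = 1, u (len g) = g & forall i j, (i <= j <= len g)%N ->
      len ((u i)^-1 * u j) = (j - i)%N].
Proof.
have [w [sw wS wg]] := word_lengthP g.
pose u i := \prod_(s <- take i w) s.
have u0 : u 0%N = 1 by rewrite /u take0 big_nil.
have un : u (len g) = g by rewrite /u -sw take_size.
have le_u i j : (i <= j <= len g)%N -> (len ((u i)^-1 * u j) <= j - i)%N.
  move=> /andP[ij jn]; apply: word_length_min; exists (drop i (take j w)); split.
  - by rewrite size_drop size_takel // sw.
  - by move=> s /mem_drop /mem_take; exact: wS.
  - rewrite /u -{2}(cat_take_drop i (take j w)) big_cat /=.
    by rewrite take_takel // mulKg.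
exists u; split=> // i j ijn; apply/eqP; rewrite eqn_leq le_u //=.
have gE : g = u i * (((u i)^-1 * u j) * ((u j)^-1 * g)).
  by rewrite -!mulgA !mulVKg.
have := word_lengthM (u i) (((u i)^-1 * u j) * ((u j)^-1 * g)); rewrite -gE.
have := word_lengthM ((u i)^-1 * u j) ((u j)^-1 * g).
have /le_u : (0 <= i <= len g)%N by lia.
have /le_u : (j <= len g <= len g)%N by lia.
rewrite u0 un invg1 mul1g; move: ijn.
by move: (len _) (len _) (len _) (len _); lia.
Qed.

Fixpoint ball_seq (n : nat) : seq G :=
  if n is m.+1 then
    1 :: [seq s * g | s <- S ++ [seq s^-1 | s <- S], g <- ball_seq m]
  else [:: 1].

Lemma mem_ball_seq n g : (len g <= n)%N -> g \in ball_seq n.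
Proof.
have [w [<- wS <-]] := word_lengthP g.
elim: w n wS => [|s w IHw] [|n] //= wS; rewrite ?big_nil ?mem_head // => wn.
rewrite big_cons inE; apply/orP; right; apply: allpairs_f; last first.
  by apply: IHw => // t wt; apply: wS; rewrite inE wt orbT.
rewrite mem_cat; have /orP[->//|Ss] := wS s (mem_head _ _).
by apply/orP; right; rewrite -[s]invgK map_f.
Qed.

End WordLength.

(** The four-point form of hyperbolicity, with an integer D above twice the
    hyperbolicity constant. *)
Lemma gromov_hyperbolic_four_point (T : Type) (d : T -> T -> nat) :
  gromov_hyperbolic d -> exists D : nat, forall w x y z,
    (d x z + d w y <= maxn (d x y + d w z) (d y z + d w x) + D)%N.
Proof.
move=> [delta delta0 hyp].
have := archi_boundP (mulr_ge0 (ler0n rat 2) delta0).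
move: (Num.bound _) => D ltD; exists D => w x y z.
have key (dwx dwy dwz dxy dyz dxz h k : rat) : (2 * h < k ->
    Num.min ((dwx + dwy - dxy) / 2) ((dwy + dwz - dyz) / 2) - h
      <= (dwx + dwz - dxz) / 2 ->
    dxz + dwy <= Num.max (dxy + dwz) (dyz + dwx) + k)%R.
  by rewrite minEle maxEle; case: ifP => ?; case: ifP => ?; lra.
rewrite -(ler_nat rat) !natrD natr_max !natrD.
exact: key ltD (hyp w x y z).
Qed.

(** * Integration of lengths known modulo 3 *)

Section Peak.
Local Open Scope ring_scope.

Definition mod3_step (a b : nat) : int :=
  if b == a %[mod 3] then 0 else if b == a.+1 %[mod 3] then 1 else -1.

Lemma mod3_stepE a b a' b' : (a <= b.+1)%N -> (b <= a.+1)%N ->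
  a' = a %[mod 3] -> b' = b %[mod 3] -> mod3_step a' b' = b%:Z - a%:Z.
Proof. by rewrite /mod3_step; case: ifP => ?; [|case: ifP => ?]; lia. Qed.

(** The points 0, ..., n are those of a geodesic, and [L i j] is the distance
    from j to the point towards which the ball around i is oriented.  Within R
    of i, the sum [phi] of the increments read from the colours [c] differs from
    [L i] by a constant.  As [L 0] and [L n] are the distances to the two ends,
    [phi] increases on the first R steps and decreases on the last R ones, so
    its maximum is in the middle part. *)
Lemma coherent_lengths_peak (n R : nat)
    (c : nat -> nat) (L : nat -> nat -> nat) :
  (0 < n)%N -> (0 < R)%N ->
  (forall i j, (i <= n)%N -> (j <= n)%N -> (i <= j + R)%N -> (j <= i + R)%N ->
    c j = L i j %[mod 3]) ->
  (forall i j, (i <= n)%N -> (j < n)%N ->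
    (L i j <= (L i j.+1).+1)%N /\ (L i j.+1 <= (L i j).+1)%N) ->
  (forall j, (j <= n)%N -> L 0%N j = j) ->
  (forall j, (j <= n)%N -> L n j = (n - j)%N) ->
  exists2 m, (R <= m <= n - R)%N &
    (L m (m - R) <= L m m)%N /\ (L m (m + R) <= L m m)%N.
Proof.
move=> n0 R0 Lc L1 L0 Ln.
pose phi j : int := \sum_(k < j) mod3_step (c k) (c k.+1).
have phiS j : phi j.+1 = phi j + mod3_step (c j) (c j.+1).
  by rewrite /phi big_ord_recr.
have phiE i j t : (i <= n)%N -> (j + t <= n)%N -> (i <= j + R)%N ->
    (j + t <= i + R)%N ->
    phi (j + t)%N - phi j = (L i (j + t)%N)%:Z - (L i j)%:Z.
  move=> le_in + le_ij; elim: t => [|t IHt] le_n le_i.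
    by rewrite addn0 !subrr.
  have {IHt} : phi (j + t)%N - phi j = (L i (j + t)%N)%:Z - (L i j)%:Z.
    by apply: IHt; lia.
  have [] : (L i (j + t) <= (L i (j + t).+1).+1)%N /\
    (L i (j + t).+1 <= (L i (j + t)).+1)%N by apply: L1; lia.
  rewrite addnS phiS => La Lb.
  rewrite (mod3_stepE La Lb); [by lia| |]; by apply: Lc; lia.
have [m le_mn maxm] : exists2 m, (m <= n)%N &
    forall j, (j <= n)%N -> phi j <= phi m.
  case: (@arg_maxP _ int 'I_n.+1 ord0 xpredT (fun j => phi j) isT) => m _ maxm.
  exists m => [|j le_jn]; first by rewrite -ltnS.
  by have := maxm (Ordinal (le_jn : (j < n.+1)%N)) isT.
have up : ~ ((m < R)%N /\ (m < n)%N).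
  move=> [mR mn]; have := phiE 0%N m 1%N; rewrite !L0 ?addn1 //.
  by have := maxm m.+1 mn; lia.
have down : ~ ((n < m + R)%N /\ (0 < m)%N).
  move=> [nmR m0]; have := phiE n m.-1 1%N.
  rewrite !Ln ?addn1 ?prednK //; last by lia.
  by have := maxm m.-1; lia.
exists m; first by lia.
have := phiE m (m - R)%N R; have := phiE m m R; rewrite subnK; last by lia.
by have := maxm (m - R)%N; have := maxm (m + R)%N; lia.
Qed.

End Peak.

(** * Hyperbolic groups *)

Section Hyperbolic.
Context (G : groupType) (S : seq G) (gS : generates S).

Local Notation len := (word_length gS).

Definition length_mod3 (g : G) : 'I_3 * bool := (inZp (len g), g == 1).

(** On the geodesic from x to y, the pattern on the ball around the m-th point
    is that of the distance to [p].  At the peak m, [p] is no farther from the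
    points m - R and m + R than from the point m, whereas the four-point
    condition gives an excess of at least R - D. *)
Lemma has_special_rule_hyperbolic :
  gromov_hyperbolic (word_dist gS) -> has_special_rule [set: G].
Proof.
move=> /gromov_hyperbolic_four_point[D hypD]; pose R := D.+1.
exists ('I_3 * bool)%type, (ball_seq S R).
exists (pattern_rule (ball_seq S R) length_mod3), (ord0, true).
apply: special_pattern_rule => [|sigma so x y sx sy].
  by rewrite /length_mod3 word_length1 eqxx; congr (_, _); apply: val_inj.
apply: contrapT => xy.
have [u [u0 un uE]] := word_length_geodesic gS (x^-1 * y).
set n := len _ in un uE.
have n0 : (0 < n)%N.
  rewrite lt0n; apply/eqP => n0; apply: xy; move: un; rewrite n0 u0.
  by move=> /(congr1 (fun g => x * g)); rewrite mulg1 mulVKg.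
have uV i j : (u i)^-1 * u j = ((u j)^-1 * u i)^-1 by rewrite invgM invgK.
have uE' i j : (i <= n)%N -> (j <= n)%N ->
    len ((u i)^-1 * u j) = (maxn i j - minn i j)%N.
  move=> le_in le_jn; have [ij|ji] := leqP i j; first by rewrite uE ?ij.
  by rewrite uV word_lengthV uE // ltnW.
have /choice[gam gamE] : forall i, exists gamma, forall f, (len f <= R)%N ->
    sigma (x * u i * f) = length_mod3 (gamma * f).
  move=> i; have [gamma sE] := so (x * u i) I.
  by exists gamma => f fR; apply: sE; exact: mem_ball_seq.
have gam1 i : sigma (x * u i) = (ord0, true) -> gam i = 1.
  have := gamE i 1; rewrite word_length1 !mulg1 => /(_ isT) -> [_].
  by move/eqP.
(* at both ends the flag identifies the translation: the pattern is centred *)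
have gam0 : gam 0%N = 1 by apply: gam1; rewrite u0 mulg1.
have gamn : gam n = 1 by apply: gam1; rewrite un mulVKg.
pose L i j := len (gam i * ((u i)^-1 * u j)).
have [||||||m /andP[Rm mR] [La Lb]] :=
    @coherent_lengths_peak n R (fun j => (sigma (x * u j)).1 : nat) L => //.
- move=> i j le_in le_jn le_ij le_ji.
  have := gamE i ((u i)^-1 * u j); rewrite -mulgA mulVKg uE' //.
  by move=> ->; [rewrite /= modn_mod|lia].
- move=> i j le_in le_jn; rewrite /L.
  have le1 k l : (k <= n)%N -> (l <= n)%N -> (k <= l.+1)%N -> (l <= k.+1)%N ->
      (len (gam i * ((u i)^-1 * u k)) <= (len (gam i * ((u i)^-1 * u l))).+1)%N.
    move=> le_kn le_ln le_kl le_lk.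
    have := word_lengthM gS (gam i * ((u i)^-1 * u l)) ((u l)^-1 * u k).
    rewrite -!mulgA mulVKg uE' //.
    by move: (len _) (len _); lia.
  by split; apply: le1; lia.
- by move=> j le_jn; rewrite /L gam0 mul1g uE' //; lia.
- by move=> j le_jn; rewrite /L gamn mul1g uE' //; lia.
pose p := (gam m * (u m)^-1)^-1.
have Lp j : word_dist gS p (u j) = L m j by rewrite /word_dist invgK -mulgA.
have Lp' j : word_dist gS (u j) p = L m j.
  by rewrite -Lp /word_dist -(word_lengthV gS (_ * p)) invgM [X in _ * X]invgK.
have := hypD (u m) (u (m - R)%N) p (u (m + R)%N).
rewrite !Lp !Lp' /word_dist !uE' /R; try lia.
by move: La Lb Rm mR; rewrite /R; move: (L _ _) (L _ _) (L _ _); lia.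
Qed.

End Hyperbolic.

(** * Subnormal series *)

Lemma special_symbol_poly (P : groupType -> Prop) :
  (forall Q, P Q -> has_special_rule [set: Q]) ->
  forall G, poly_by P G -> special_symbol_property G.
Proof.
move=> PR G [k [N [N0 Nk step]]]; apply: special_symbol_property_of_rule.
rewrite -Nk; have : (k <= k)%N by [].
elim: {1 3}k => [_|i IHi lt_ik].
  rewrite N0; exists bool, [::], (fun=> True), true; split=> //.
    by move=> sigma _ x y -> ->.
  by exists (fun=> true) => //; exists 1.
have [nN PQ] := step i lt_ik.
by apply: (has_special_rule_quotient (nN := nN)); [exact/IHi/ltnW|exact: PR].
Qed.

Theorem theorem0p3 :
  (forall G : groupType, poly_hyperbolic G -> special_symbol_property G) /\
  (forall G : groupType, polycyclic G -> special_symbol_property G).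
Proof.
split; apply: special_symbol_poly => Q.
  by move=> [S [gS hyp]]; exact: has_special_rule_hyperbolic hyp.
exact: has_special_rule_cyclic.
Qed.
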